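(* For $2<n<\omega$, the variety $\mathsf{RDf}_n$ is not atom-canonical: there is an atomic $\mathfrak A\in\mathsf{RDf}_n$ with $\mathfrak{Cm}\mathsf{At}\mathfrak A\notin\mathsf{RDf}_n$. Hence $\mathsf{RDf}_n$ is not closed under Dedekind–MacNeille completions.
   Context: $\mathsf{RDf}_n$ is the class of representable diagonal-free cylindric algebras of dimension $n$ (Boolean algebras with cylindrifications $c_i$, $i<n$, isomorphic to subdirect products of diagonal-free cylindric set algebras with units ${}^nU$). For an atomic algebra $\mathfrak A$, $\mathfrak{Cm}\mathsf{At}\mathfrak A$ is the complex algebra over its atom structure, which for completely additive algebras is the Dedekind–MacNeille completion of $\mathfrak A$. *)

(* Defs.v *)
From HB Require Import structures.
From mathcomp Require Import all_boot all_order.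
From mathcomp Require Import boolp classical_sets.
Set Implicit Arguments.
Unset Strict Implicit.
Unset Printing Implicit Defensive.

Local Open Scope classical_set_scope.
Local Open Scope order_scope.

(* The similarity type of diagonal-free cylindric algebras of dimension n:
   a Boolean algebra with n unary operations.  No axiom is imposed on cyl here;
   those of Df_n hold in every member of RDf n. *)
Record cylBA (n : nat) := CylBA {
  cylBA_disp : Order.disp_t;
  cylBA_sort :> ctbDistrLatticeType cylBA_disp;
  cyl : 'I_n -> cylBA_sort -> cylBA_sort
}.

Definition is_hom (n : nat) (A B : cylBA n) (f : A -> B) : Prop :=
  [/\ f \bot = \bot, f \top = \top,
      {morph f : x y / x `&` y}, {morph f : x y / x `|` y}
    & {morph f : x / ~` x}] /\
  (forall i, {morph f : x / cyl i x}).

(* The algebra of all subsets of ^nU, with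
   c_i X = {s | some t in X agrees with s off i}. *)
Definition full_set_algebra (n : nat) (U : Type) : cylBA n :=
  @CylBA n _ (set ('I_n -> U))
    (fun i X => [set s | exists2 t, X t & forall j, j != i -> t j = s j]).

(* Up to isomorphism: a subalgebra of a full set algebra. *)
Definition set_algebra (n : nat) (A : cylBA n) : Prop :=
  exists (U : Type) (f : A -> full_set_algebra n U), is_hom f /\ injective f.

(* Up to isomorphism: a subalgebra of the product of the B j that projects
   onto each factor.  J may be empty. *)
Definition subdirect_product (n : nat) (A : cylBA n)
    (J : Type) (B : J -> cylBA n) : Prop :=
  exists f : forall j, A -> B j,
    [/\ forall j, is_hom (f j),
        forall j (y : B j), exists x, f j x = y
      & forall x y, (forall j, f j x = f j y) -> x = y].

Definition RDf (n : nat) (A : cylBA n) : Prop :=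
  exists (J : Type) (B : J -> cylBA n),
    (forall j, set_algebra (B j)) /\ subdirect_product A B.

Definition is_atom (n : nat) (A : cylBA n) (a : A) : Prop :=
  a <> \bot /\ forall x : A, x <= a -> x = \bot \/ x = a.

Definition atomic (n : nat) (A : cylBA n) : Prop :=
  forall x : A, x <> \bot -> exists2 a : A, is_atom a & a <= x.

Record atom_structure (n : nat) := AtomStructure {
  atom_sort :> Type;
  atom_rel : 'I_n -> atom_sort -> atom_sort -> Prop
}.

Definition At (n : nat) (A : cylBA n) : atom_structure n :=
  @AtomStructure n {a : A | is_atom a}
    (fun i a b => sval a <= cyl i (sval b)).

Definition Cm (n : nat) (F : atom_structure n) : cylBA n :=
  @CylBA n _ (set F) (fun i X => [set a | exists2 b, X b & atom_rel i a b]).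

Definition atom_canonical (n : nat) (K : cylBA n -> Prop) : Prop :=
  forall A : cylBA n, K A -> atomic A -> K (Cm (At A)).

Definition complete (n : nat) (A : cylBA n) : Prop :=
  forall X : set A, supremums X !=set0.

(* B is a complete algebra containing (via e) A as a dense subalgebra, and
   each c_i b is the supremum of the c_i a for a in A below b (Monk's
   extension of the operations, which determines B up to isomorphism). *)
Definition DM_completion (n : nat) (A B : cylBA n) : Prop :=
  complete B /\
  exists e : A -> B,
    [/\ is_hom e, injective e,
        forall b : B, b <> \bot -> exists2 a : A, a <> \bot & e a <= b
      & forall i (b : B),
          supremums [set e (cyl i a) | a in [set a : A | e a <= b]] (cyl i b)].

Definition closed_under_DM_completions (n : nat) (K : cylBA n -> Prop) : Prop :=
  forall A B : cylBA n, K A -> DM_completion A B -> K B.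

(* Main.v *)
(* Points of a representation carry marks, and points of different sorts
   (coordinates 0, 1, 2) are joined by edges with labels (i, Some (s, k)), whose
   colour is (i, k), or (i, None), a limit at infinity of labels of index i.  The
   marks on a triangle single out a triple of colours, and the triangle is
   forbidden when its indices are the singled-out ones and no two of its edges
   are "adjacent", i.e. share s but deviate differently from the singled-out k.
   Hence two labels of finite s leave, for each index, finitely or cofinitely
   many choices for the third edge, so sets that see only finitely many values of s are closed
   under cylindrification: they form a representable algebra A, which cannot see
   the colours.  In Cm (At A) every edge has one of six colours, and marks can be
   chosen that guess all the colours of a triangle, which is then forbidden. *)
Require Import Defs.
From HB Require Import structures.
From mathcomp Require Import all_boot all_order.
From mathcomp Require Import boolp classical_sets.
Set Implicit Arguments.
Unset Strict Implicit.
Unset Printing Implicit Defensive.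

(** * Coloured labels, marks and consistent triangles *)

Inductive three := S0 | S1 | S2.

Definition three_eqb (d d' : three) : bool :=
  match d, d' with S0, S0 | S1, S1 | S2, S2 => true | _, _ => false end.

Lemma three_eqP : Equality.axiom three_eqb.
Proof. by case=> -[] /=; constructor. Qed.

HB.instance Definition _ := hasDecEq.Build three three_eqP.

Definition nxt (d : three) : three :=
  match d with S0 => S1 | S1 => S2 | S2 => S0 end.

Definition third (d d' : three) : three :=
  match d, d' with
  | S0, S1 | S1, S0 => S2 | S0, S2 | S2, S0 => S1 | S1, S2 | S2, S1 => S0
  | _, _ => nxt d
  end.

Lemma thirdC d d' : third d d' = third d' d.
Proof. by case: d d' => -[]. Qed.

Lemma third_neql d d' : third d d' <> d.
Proof. by case: d d' => -[]. Qed.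

Lemma third_neqr d d' : third d d' <> d'.
Proof. by case: d d' => -[]. Qed.

Definition colour := (three * bool)%type.

(** All sorts share one type of marks, but [target] reads one component at each sort. The components
    take more and more arguments, so that the guesses can be fixed from the last to the first
    without circularity. *)
Definition mark := (colour * (colour -> colour) *
  (colour -> (colour -> colour) -> colour))%type.

(* The colour singled out for the edge opposite to [d]; throughout, the edges of a
   triangle are indexed by the opposite vertex. *)
Definition target (u : three -> mark) (d : three) : colour :=
  match d with
  | S0 => (u S0).1.1
  | S1 => (u S1).1.2 (u S0).1.1
  | S2 => (u S2).2 (u S0).1.1 (u S1).1.2
  end.

Definition label := (three * option (nat * bool))%type.

Definition standard (l : label) : bool := l.2 != None.

(** Labels of one index form the one-point compactification of the discrete set [nat * bool], and
    merging everything from [N] on with the limit [None] gives its basic clopen partitions. *)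
Definition trunc (N : nat) (l : label) : label :=
  (l.1, if l.2 is Some sk then if sk.1 < N then Some sk else None else None).

(** Here [k (+) z] is the deviation of the bit [k] from the target bit [z]. Two limits are adjacent
    because they are limits of adjacent pairs with growing [s]. *)
Definition adjacent (z z' : bool) (l l' : label) : bool :=
  match l.2, l'.2 with
  | None, None => true
  | Some (s, k), Some (s', k') => (s == s') && (k (+) z != k' (+) z')
  | _, _ => false
  end.

Definition consistent (u : three -> mark) (e : three -> label) : Prop :=
  (exists d, (e d).1 <> (target u d).1) \/
  (exists d d', d <> d' /\
     adjacent (target u d).2 (target u d').2 (e d) (e d')).

Definition upd (T : Type) (f : three -> T) (d : three) (a : T) : three -> T :=
  fun d' => if d' == d then a else f d'.

Lemma upd_eq (T : Type) (f : three -> T) d a : upd f d a d = a.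
Proof. by rewrite /upd eqxx. Qed.

Lemma upd_neq (T : Type) (f : three -> T) d a d' : d' <> d -> upd f d a d' = f d'.
Proof. by rewrite /upd => /eqP/negbTE ->. Qed.

Lemma adjacentC z z' l l' : adjacent z z' l l' = adjacent z' z l' l.
Proof.
case: l l' => [i [[s k]|]] [i' [[s' k']|]] //=.
by rewrite /adjacent /= (eq_sym s) (eq_sym (k (+) z)).
Qed.

Lemma trunc_idx N l l' : trunc N l = trunc N l' -> l.1 = l'.1.
Proof. by case. Qed.

(* An adjacency through an edge that the truncation does not see is transported
   to any other unseen label by moving the partner edge along. *)
Lemma adjacent_transfer N z z' l m b : adjacent z z' l m ->
  trunc N b = trunc N l ->
  exists2 m', adjacent z z' b m' & trunc N m' = trunc N m.
Proof.
case: l m b => [i [[s k]|]] [j [[t h]|]] [c [[q w]|]] //=;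
  rewrite /trunc /adjacent /=.
- case/andP=> /eqP <- ne [_ E].
  move: E; case: (ltnP s N) => sN; case: (ltnP q N) => qN // E.
    by case: E => -> ->; exists (j, Some (s, h)); rewrite /= ?eqxx ?sN.
  (* This bit has, relative to [z'], the deviation opposite to that of [w] relative to [z]. *)
  exists (j, Some (q, ~~ (w (+) z) (+) z')) => /=.
    by rewrite eqxx; case: w z z' {ne} => -[] [].
  by rewrite ltnNge qN.
- case/andP=> /eqP <- ne [_ E].
  exists (j, None) => //=.
  by move: E; case: (ltnP s N).
- move=> _ E; exists (j, Some (q, ~~ (w (+) z) (+) z')) => /=.
    by rewrite eqxx; case: w z z' {E} => -[] [].
  by move: E => -[_]; case: (ltnP q N).
- by move=> _ _; exists (j, None).
Qed.

(** Truncation keeps indices, so an index off target stays off target. An adjacency away from edge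
    [d] survives as well, and one through [d] is restored by moving its other edge. *)
Lemma consistent_transfer u e N d b : consistent u e ->
  trunc N b = trunc N (e d) ->
  exists e', [/\ consistent u e', e' d = b
    & forall d', trunc N (e' d') = trunc N (e d')].
Proof.
have updE f d' : trunc N b = trunc N (f d) ->
    trunc N (upd f d b d') = trunc N (f d').
  by move=> tb; have [->|/eqP ne] := eqVneq d' d; rewrite ?upd_eq ?upd_neq.
move=> [[d0 ne]|[d1 [d2 [ne adj]]]] tb.
  exists (upd e d b); split; rewrite ?upd_eq //; last by move=> d'; exact: updE.
  left; exists d0; have [d0d|/eqP d0d] := eqVneq d0 d; last by rewrite upd_neq.
  by rewrite d0d upd_eq (trunc_idx tb) -d0d.
wlog d2d : d1 d2 ne adj / d2 <> d.
  move=> W; have [E|/eqP d2d] := eqVneq d2 d; last exact: W adj d2d.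
  by apply: (W d2 d1); [exact: nesym | rewrite adjacentC | rewrite -E].
have [d1d|/eqP d1d] := eqVneq d1 d; last first.
  exists (upd e d b); split; rewrite ?upd_eq //; last by move=> d'; exact: updE.
  by right; exists d1, d2; rewrite !upd_neq.
subst d1; have [m adj' tm] := adjacent_transfer adj tb.
exists (upd (upd e d2 m) d b); split; rewrite ?upd_eq //.
  by right; exists d, d2; rewrite upd_eq upd_neq ?upd_eq.
move=> d'; rewrite updE; last by rewrite upd_neq.
by have [->|/eqP ne'] := eqVneq d' d2; rewrite ?upd_eq ?upd_neq.
Qed.

Lemma consistent_standardize u e N : consistent u e ->
  exists e', [/\ consistent u e', forall d, standard (e' d),
    forall d, trunc N (e' d) = trunc N (e d)
    & forall d, standard (e d) -> e' d = e d].
Proof.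
move=> ok.
(* All new labels use [s = N], just out of sight of [trunc N], with deviation [d != d0]; hence a
   former limit at [d0] is adjacent to every other former limit. *)
pose g d0 d : label := if (e d).2 is Some _ then e d
  else ((e d).1, Some (N, (d != d0) (+) (target u d).2)).
have g1 d0 d : (g d0 d).1 = (e d).1 by rewrite /g; case: (e d) => i [].
suff [d0 okd0] : exists d0, consistent u (g d0).
  exists (g d0); split=> // d; rewrite /g /standard /trunc;
    case: (e d) => i [] //=.
  by rewrite ltnn.
case: ok => [[d ne]|[d [d' [ne adj]]]].
  by exists S0; left; exists d; rewrite g1.
exists d; right; exists d, d'; split=> //.
have /eqP/negbTE ne' : d' <> d by move=> E; exact: ne.
move: adj; rewrite /g /adjacent; case: (e d) => i [[s k]|];
  case: (e d') => i' [[s' k']|] //= _.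
by rewrite !eqxx ne' /=; case: (target u d).2; case: (target u d').2.
Qed.

(** A second edge copies the [s] of [b] with the opposite deviation, whatever the marks are. This
    lets a vertex of a standard triangle be replaced by one with any prescribed mark. *)
Lemma consistent_free u d b : standard b ->
  exists e, [/\ consistent u e, e d = b & forall d', standard (e d')].
Proof.
case: b => i [[s k]|] // _.
have [d1 d1d] : exists d1, d1 <> d by exists (nxt d); case: d.
pose f (d' : three) : label :=
  (S0, Some (s, ~~ (k (+) (target u d).2) (+) (target u d1).2)).
exists (upd f d (i, Some (s, k))); split; rewrite ?upd_eq //; last first.
  by move=> d'; rewrite /upd; case: ifP.
right; exists d, d1; split; first by move=> E; exact: d1d.
by rewrite upd_eq upd_neq // /adjacent /= eqxx; case: k (target u d).2
  (target u d1).2 {f} => -[] [].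
Qed.

(** All deviations vanish, so no two edges deviate differently, even if they share [s]. A
    representation of the complex algebra will force such a triangle. *)
Lemma inconsistent_target u e :
  (forall d, exists s, e d = ((target u d).1, Some (s, (target u d).2))) ->
  ~ consistent u e.
Proof.
move=> H [[d]|[d [d' [_]]]].
  by have [s ->] := H d.
have [s ->] := H d; have [s' ->] := H d'.
by rewrite /adjacent /= !addbb eqxx andbF.
Qed.

Lemma consistent_blank u e d d' : d <> d' -> (e d).2 = None ->
  (e d').2 = None -> consistent u e.
Proof. by move=> ne E E'; right; exists d, d'; rewrite /adjacent E E'. Qed.

(** * Freely adjoined vertices and the consistency of their triangles *)

(* [Node d u l v] is adjoined at sort [d] to the two vertices [v d'], [d' <> d], so
   as to form with them a triangle with marks [u] and labels [l]; the value [v d]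
   is irrelevant. *)
Inductive vertex :=
  | Root of three & mark
  | Node of three & (three -> mark) & (three -> label) & (three -> vertex).

Definition sort_of (s : vertex) : three :=
  match s with Root d _ => d | Node d _ _ _ => d end.

Definition mark_of (s : vertex) : mark :=
  match s with Root _ a => a | Node d u _ _ => u d end.

Definition labels_of (s : vertex) : three -> label :=
  match s with Root _ _ => fun=> (S0, None) | Node _ _ l _ => l end.

Definition owns (s t : vertex) : Prop :=
  if s is Node d _ _ v then sort_of t <> d /\ v (sort_of t) = t else False.

Definition marks (s t : vertex) (a : mark) : three -> mark :=
  fun d => if d == sort_of s then mark_of s
           else if d == sort_of t then mark_of t else a.

(* The singled-out index for the edge [s]-[t] in the triangle whose third vertex
   is owned by [r], where [r] is [s] or [t]. *)
Definition avoid (s t r : vertex) : three :=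
  if r is Node _ u _ v then
    let d := third (sort_of s) (sort_of t) in
    (target (marks s t (mark_of (v d))) d).1
  else S0.

(** An edge declared by neither end gets a limit label. Each end owns at most one vertex of the
    remaining sort, hence forbids at most one index, and three indices leave one that differs from
    both. *)
Definition edge (s t : vertex) : label :=
  if `[< owns s t >] then labels_of s (third (sort_of s) (sort_of t))
  else if `[< owns t s >] then labels_of t (third (sort_of s) (sort_of t))
  else (third (avoid s t s) (avoid s t t), None).

Definition edges (p : three -> vertex) (d : three) : label :=
  edge (p (nxt d)) (p (nxt (nxt d))).

Fixpoint valid (s : vertex) : Prop :=
  if s is Node d u l v then
    [/\ forall d', d' <> d ->
          [/\ valid (v d'), sort_of (v d') = d' & mark_of (v d') = u d'],
        l d = edges v d & consistent u l]
  else True.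

(** Ownership strictly decreases this measure, which makes it asymmetric and provides a deepest
    vertex in any triple. *)
Fixpoint depth (s : vertex) : nat :=
  if s is Node _ _ _ v then (depth (v S0) + depth (v S1) + depth (v S2)).+1
  else 0.

Lemma owns_depth s t : owns s t -> depth t < depth s.
Proof.
case: s => // d u l v [_ <-]; rewrite [depth (Node _ _ _ _)]/= ltnS.
by case: (sort_of t); [rewrite -addnA leq_addr | rewrite addnAC leq_addl | exact: leq_addl].
Qed.

Lemma owns_asym s t : owns s t -> ~ owns t s.
Proof. by move=> /owns_depth lt /owns_depth; rewrite ltnNge (ltnW lt). Qed.

Lemma edgeC s t : sort_of s <> sort_of t -> edge s t = edge t s.
Proof.
move=> ne; rewrite /edge thirdC.
case: (asboolP (owns s t)) => [o|_].
  by case: asboolP => // o'; case: (owns_asym o).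
case: (asboolP (owns t s)) => // _; congr pair.
have marksC a : marks s t a = marks t s a.
  apply: funext => d; rewrite /marks; case: eqP => // ->.
  by case: eqP.
have avoidC r : avoid s t r = avoid t s r.
  by rewrite /avoid thirdC; case: r => // *; rewrite marksC.
by rewrite !avoidC thirdC.
Qed.

Definition sorted_triple (p : three -> vertex) : Prop :=
  forall d, sort_of (p d) = d.

Lemma edges_third p d d' : sorted_triple p -> d <> d' ->
  edges p (third d d') = edge (p d) (p d').
Proof.
by move=> sp; case: d d' => -[] // _; rewrite /edges //= edgeC // !sp.
Qed.

Lemma edge_owns s t : owns s t ->
  edge s t = labels_of s (third (sort_of s) (sort_of t)).
Proof. by move=> o; rewrite /edge asboolT. Qed.

Lemma edge_free s t : ~ owns s t -> ~ owns t s ->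
  edge s t = (third (avoid s t s) (avoid s t t), None).
Proof. by move=> o o'; rewrite /edge !asboolF. Qed.

Lemma three_cover (d d' x : three) : d <> d' -> [\/ x = d, x = d' | x = third d d'].
Proof.
by case: d d' x => -[] -[] // ne;
  first [by constructor 1 | by constructor 2 | by constructor 3].
Qed.

(** The two edges at [w] are declared by its vertex; the opposite edge joins older vertices and is
    covered by the hypothesis on [l w]. *)
Lemma edges_owned p w u l v : sorted_triple p -> p w = Node w u l v ->
  (forall d, d <> w -> v d = p d) -> l w = edges v w ->
  edges p = l.
Proof.
move=> sp pw vp lw; apply: funext => d.
have [->|/eqP dw] := eqVneq d w.
  by rewrite lw /edges !vp //; case: (w).
pose d' := third w d.
have wd' : w <> d' by exact/nesym/third_neql.
have -> : d = third w d' by move: dw; rewrite /d'; case: (w) (d) => -[].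
rewrite edges_third // edge_owns ?sp ?pw //=.
by rewrite sp; split; [exact: nesym | rewrite vp //; exact: nesym].
Qed.

Lemma argmax3 (f : three -> nat) : exists w, forall d, f d <= f w.
Proof.
case: (leqP (f S0) (f S1)) => h01.
  case: (leqP (f S1) (f S2)) => h12.
    by exists S2; case=> //; exact: leq_trans h12.
  by exists S1; case=> //; exact: ltnW.
case: (leqP (f S0) (f S2)) => h02.
  by exists S2; case=> //; exact: leq_trans (ltnW h01) h02.
by exists S0; case=> //; exact: ltnW.
Qed.

(* In a triple, look at a deepest vertex [w].  If it owns both other vertices the
   triple is the one declared when [w] was adjoined; if it owns one of them, the
   free edge at [w] avoids the forbidden index; otherwise two edges are blank. *)
Lemma edges_consistent p : sorted_triple p -> (forall d, valid (p d)) ->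
  consistent (fun d => mark_of (p d)) (edges p).
Proof.
move=> sp vp.
have [w wmax] : exists w, forall d, depth (p d) <= depth (p w).
  exact: (argmax3 (fun d => depth (p d))).
have noown d : ~ owns (p d) (p w).
  by move=> /owns_depth; rewrite ltnNge wmax.
case: (pselect (forall d, d <> w -> owns (p w) (p d))) => [ow|].
  case E : (p w) (vp w) (sp w) => [d a|d u l v] /=.
    by have := ow _ (@third_neql w w); rewrite E.
  move=> [nb lw okl] dw; subst d.
  have vE d : d <> w -> v d = p d.
    by move=> dw; have := ow d dw; rewrite E /= sp => -[].
  rewrite (edges_owned sp E vE lw); suff -> : (fun d => mark_of (p d)) = u by [].
  apply: funext => d; have [->|/eqP dw] := eqVneq d w; first by rewrite E.
  by rewrite -vE //; case: (nb d dw).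
move/existsNP => [d /not_implyP[dw nod]].
pose c := third w d.
have cw : c <> w by exact: third_neql.
have cd : c <> d by exact: third_neqr.
have free x : x <> w -> ~ owns (p w) (p x) -> edges p (third w x) =
    (third (avoid (p w) (p x) (p w)) (avoid (p w) (p x) (p x)), None).
  by move=> xw no; rewrite edges_third //; [exact: edge_free | exact: nesym].
have wd : w <> d by exact: nesym.
case: (pselect (owns (p w) (p c))) => oc; last first.
  apply: (@consistent_blank _ _ (third w d) (third w c)); rewrite ?free //.
  by rewrite /c; case: (w) (d) wd => -[].
left; exists c; rewrite -[in edges _ _]/(third w d) free //.
have -> : avoid (p w) (p d) (p w) = (target (fun x => mark_of (p x)) c).1.
  move: oc; rewrite /avoid !sp -/c; case E : (p w) => [//|x u l v] [_ vc].
  have := sp w; rewrite E /= => xw.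
  move: vc; rewrite sp => ->; congr (target _ _).1; apply: funext => y.
  rewrite /marks sp /= xw; case: (y =P w) => [->|yw]; first by rewrite E /= xw.
  case: (y =P d) => [-> //|yd].
  by case: (three_cover y wd) => // ->.
exact: third_neql.
Qed.

(** * Points of the set algebra and their moves along one coordinate *)

Definition mark0 : mark := ((S0, false), id, fun _ _ => (S0, false)).

(** The unit must be a full power of one base, so sorts and validity cannot be imposed on points;
    instead each of the three coordinates is read as a valid vertex of the right sort. *)
Definition normalize (d : three) (s : vertex) : vertex :=
  if `[< valid s /\ sort_of s = d >] then s else Root d mark0.

Lemma normalize_valid d s : valid (normalize d s).
Proof. by rewrite /normalize; case: asboolP => [[]|]. Qed.

Lemma sort_normalize d s : sort_of (normalize d s) = d.
Proof. by rewrite /normalize; case: asboolP => [[]|]. Qed.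

Lemma normalize_id d s : valid s -> sort_of s = d -> normalize d s = s.
Proof. by move=> vs ss; rewrite /normalize asboolT. Qed.

(** Only these three coordinates are visible to marks and labels; a move along any other one
    preserves both, so the construction is three-dimensional for every [m]. *)
Definition coord (m : nat) (d : three) : 'I_m.+3 :=
  match d with
  | S0 => @Ordinal m.+3 0 isT
  | S1 => @Ordinal m.+3 1 isT
  | S2 => @Ordinal m.+3 2 isT
  end.

Lemma coord_inj m : injective (@coord m).
Proof. by case=> -[]. Qed.

Lemma coord_neq m (d d' : three) : d' <> d -> coord m d' != coord m d.
Proof. by move=> ne; apply/eqP => /coord_inj. Qed.

Definition point (m : nat) := 'I_m.+3 -> vertex.

Definition proj (m : nat) (p : point m) (d : three) : vertex :=
  normalize d (p (coord m d)).

Definition marking (m : nat) (p : point m) (d : three) : mark :=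
  mark_of (proj p d).

Definition labelling (m : nat) (p : point m) : three -> label := edges (proj p).

Definition agree_off (m : nat) (i : 'I_m.+3) (p q : point m) : Prop :=
  forall j, j != i -> p j = q j.

Lemma labelling_consistent m (p : point m) : consistent (marking p) (labelling p).
Proof.
by apply: edges_consistent => d; [exact: sort_normalize | exact: normalize_valid].
Qed.

Lemma proj_off m i (p q : point m) d : agree_off i p q -> coord m d != i ->
  proj p d = proj q d.
Proof. by move=> pq di; rewrite /proj pq. Qed.

Lemma marking_off m i (p q : point m) d : agree_off i p q -> coord m d != i ->
  marking p d = marking q d.
Proof. by move=> pq di; rewrite /marking (proj_off pq di). Qed.

Lemma labelling_off m (p q : point m) d : agree_off (coord m d) p q ->
  labelling p d = labelling q d.
Proof.
move=> pq; rewrite /labelling /edges.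
by rewrite !(proj_off (q := q) pq) //; apply: coord_neq; case: (d).
Qed.

Lemma proj_off_high m i (p q : point m) : agree_off i p q ->
  (forall d, coord m d != i) -> proj p = proj q.
Proof. by move=> pq hi; apply: funext => d; exact: proj_off (hi d). Qed.

Lemma coordP m (i : 'I_m.+3) :
  (exists d, i = coord m d) \/ (forall d, coord m d != i).
Proof.
case: (pselect (exists d, i = coord m d)) => [|H]; first by left.
by right=> d; apply/eqP => E; apply: H; exists d.
Qed.

(** The coordinate [d] is replaced by a new [Node] that declares [u] and [l] over the two remaining
    projections of [p]; the hypotheses are exactly its validity. *)
Lemma extend m (p : point m) d u l : consistent u l ->
  (forall d', d' <> d -> u d' = marking p d') -> l d = labelling p d ->
  exists q, [/\ agree_off (coord m d) q p, marking q = u & labelling q = l].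
Proof.
move=> ok up lp; pose s := Node d u l (proj p).
have vs : valid s.
  split=> // d' ne; split; [exact: normalize_valid | exact: sort_normalize |].
  by rewrite up.
pose q : point m := fun j => if j == coord m d then s else p j.
have qp : agree_off (coord m d) q p by move=> j /negbTE ji; rewrite /q ji.
have qd : proj q d = s by rewrite /proj /q eqxx normalize_id.
exists q; split=> //.
  apply: funext => d'; have [->|/eqP ne] := eqVneq d' d; first by rewrite /marking qd.
  by rewrite (marking_off qp) ?up //; exact: coord_neq.
apply: (edges_owned _ qd) => //; first by move=> x; exact: sort_normalize.
by move=> x xd; rewrite (proj_off qp) //; exact: coord_neq.
Qed.

(** Set the vertex of sort [S1], then that of sort [S2] together with the edge between them, and
    finally the one of sort [S0]. The intermediate triangles are consistent because two of their
    edges are limits. *)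
Lemma realize m u l : consistent u l ->
  exists p : point m, marking p = u /\ labelling p = l.
Proof.
move=> ok; pose p0 : point m := fun=> Root S0 mark0.
pose blank (d : three) (b : label) : three -> label := upd (fun=> (S0, None)) d b.
have bE d b d' : d' <> d -> (blank d b d').2 = None by move=> ?; rewrite /blank upd_neq.
have [|d' ne| |p1 [_ m1 l1]] := @extend m p0 S1 (upd (marking p0) S1 (u S1))
    (blank S1 (labelling p0 S1)).
- by apply: (@consistent_blank _ _ S0 S2); rewrite ?bE.
- by rewrite upd_neq.
- by rewrite /blank upd_eq.
have [|d' ne| |p2 [_ m2 l2]] := @extend m p1 S2 (upd (marking p1) S2 (u S2))
    (upd (upd (fun=> (S0, None)) S0 (l S0)) S2 (labelling p1 S2)).
- by apply: (@consistent_blank _ _ S1 S2) => //; rewrite upd_eq l1 bE.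
- by rewrite upd_neq.
- by rewrite upd_eq.
have [|||q [_ mq lq]] := @extend m p2 S0 u l; [by []| | |by exists q].
- by case=> // _; rewrite m2 ?upd_eq // upd_neq // m1 upd_eq.
- by rewrite l2 upd_neq // upd_eq.
Qed.

(** * Finite approximation of points and back-and-forth *)

Definition sim (m N : nat) (p q : point m) : Prop :=
  marking p = marking q /\
  forall d, trunc N (labelling p d) = trunc N (labelling q d).

Definition std (m : nat) (p : point m) : Prop :=
  forall d, standard (labelling p d).

Lemma sim_sym m N (p q : point m) : sim N p q -> sim N q p.
Proof. by case=> mpq lpq; split=> // d; rewrite lpq. Qed.

Lemma trunc_leq N N' l l' : N <= N' -> trunc N' l = trunc N' l' ->
  trunc N l = trunc N l'.
Proof.
move=> NN; case: l l' => [i [[s k]|]] [i' [[s' k']|]] //=; rewrite /trunc /=.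
- case=> ->; case: (ltnP s N') => s1; case: (ltnP s' N') => s2 //.
    by case=> -> ->.
  by move=> _; rewrite !ltnNge !(leq_trans NN).
- by case=> ->; case: (ltnP s N') => // s1 _; rewrite ltnNge (leq_trans NN).
- by case=> ->; case: (ltnP s' N') => // s1 _; rewrite [_ < N]ltnNge (leq_trans NN).
Qed.

Lemma sim_leq m N N' (p q : point m) : N <= N' -> sim N' p q -> sim N p q.
Proof. by move=> NN [mpq lpq]; split=> // d; exact: trunc_leq (lpq d). Qed.

(** The opposite edges of [p] and [q] agree up to [trunc N], and [consistent_transfer] adjusts the
    other two edges within that precision. The level [N] does not grow, so cylindrifications of tame
    sets are tame. *)
Lemma sim_back m N i (p q p' : point m) : sim N p q -> agree_off i p' p ->
  exists2 q', agree_off i q' q & sim N p' q'.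
Proof.
move=> [mpq lpq] p'p; case: (coordP i) => [[d id]|hi]; last first.
  by exists q => //; rewrite /sim /marking /labelling (proj_off_high p'p hi).
subst i; have [|l' [okl ld tl]] := @consistent_transfer _ _ N d (labelling q d)
  (labelling_consistent p').
  by rewrite -lpq (labelling_off p'p).
have [d' ne|q' [q'q mq lq]] := extend (p := q) okl _ ld.
  by rewrite -mpq (marking_off p'p) //; exact: coord_neq.
by exists q' => //; split=> // e; rewrite lq tl.
Qed.

(** The edge opposite to the moved coordinate is already standard, so standardizing changes only
    edges at the new vertex. *)
Lemma std_back m N i (p p' : point m) : std p -> agree_off i p' p ->
  exists q, [/\ agree_off i q p, std q & sim N p' q].
Proof.
move=> sp p'p; case: (coordP i) => [[d id]|hi]; last first.
  by exists p'; split=> //; rewrite /std /labelling (proj_off_high p'p hi).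
subst i; have [l' [okl sl tl kl]] := consistent_standardize N (labelling_consistent p').
have [d' ne| |q [qp mq lq]] := extend (p := p) (d := d) okl.
- by rewrite (marking_off p'p) //; exact: coord_neq.
- by rewrite kl (labelling_off p'p).
by exists q; split=> // [e|]; [rewrite lq | split=> // e; rewrite lq tl].
Qed.

Lemma std_sim m N (p : point m) : exists2 q, std q & sim N p q.
Proof.
have [l' [okl sl tl kl]] := consistent_standardize N (labelling_consistent p).
have [q [mq lq]] := realize m okl.
by exists q; [move=> d; rewrite lq | split=> // d; rewrite lq tl].
Qed.

Lemma std_sim_eq m (p : point m) : std p ->
  exists N, forall q, sim N p q -> marking q = marking p /\ labelling q = labelling p.
Proof.
move=> sp; pose h d := if (labelling p d).2 is Some sk then sk.1 else 0.
have [w hw] := argmax3 h.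
(* Above the largest [s] on the triangle, truncation loses nothing: standard types are isolated. *)
exists (h w).+1 => q [mpq lpq]; split=> //; apply: funext => d.
have := lpq d; have := sp d; have := hw d; rewrite /h /standard /trunc.
case: (labelling p d) (labelling q d) => [i [[s k]|]] [i' [[s' k']|]] //= le _;
  rewrite ltnS le; by [case: ifP => // _ [-> -> ->] | case].
Qed.

Lemma mark_free m (p : point m) d a : std p ->
  exists q, [/\ agree_off (coord m d) q p, std q & marking q d = a].
Proof.
move=> sp; have [l [okl ld sl]] := consistent_free (upd (marking p) d a) d (sp d).
have [d' ne|q [qp mq lq]] := extend (p := p) okl _ ld.
  by rewrite upd_neq.
by exists q; split=> //; [move=> e; rewrite lq | rewrite mq upd_eq].
Qed.

(** * The representable algebra of tame sets *)

Local Open Scope classical_set_scope.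

Definition tame (m : nat) (X : set (point m)) : Prop :=
  exists N, forall p q, sim N p q -> X p -> X q.

Definition tame_set (m : nat) := {X : set (point m) | `[< tame X >]}.

HB.instance Definition _ (m : nat) := Choice.on (tame_set m).

Definition Tame (m : nat) (X : set (point m)) (tX : tame X) : tame_set m :=
  exist _ X (asboolT tX).

Lemma tame_val m (X : tame_set m) : tame (val X).
Proof. exact/asboolP/(valP X). Qed.

Lemma tame0 m : tame (@set0 (point m)).
Proof. by exists 0. Qed.

Lemma tameT m : tame (@setT (point m)).
Proof. by exists 0. Qed.

Lemma tameC m (X : set (point m)) : tame X -> tame (~` X).
Proof.
by move=> [N hX]; exists N => p q /sim_sym pq nXp Xq; exact/nXp/(hX q).
Qed.

Lemma tameI m (X Y : set (point m)) : tame X -> tame Y -> tame (X `&` Y).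
Proof.
move=> [N hX] [M hY]; exists (maxn N M) => p q pq [Xp Yp].
by split; [apply: hX Xp | apply: hY Yp]; apply: sim_leq pq;
  rewrite ?leq_maxl ?leq_maxr.
Qed.

Lemma tameU m (X Y : set (point m)) : tame X -> tame Y -> tame (X `|` Y).
Proof.
by move=> tX tY; rewrite -[_ `|` _]setCK setCU; apply/tameC/tameI; exact: tameC.
Qed.

Lemma tameD m (X Y : set (point m)) : tame X -> tame Y -> tame (X `\` Y).
Proof. by move=> tX tY; rewrite setDE; apply/tameI/tameC. Qed.

Lemma tame_cyl m (i : 'I_m.+3) (X : set (point m)) : tame X ->
  tame (@cyl _ (full_set_algebra m.+3 vertex) i X).
Proof.
move=> [N hX]; exists N => p q pq [p' Xp' p'p].
have [q' q'q p'q'] := sim_back pq p'p.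
by exists q' => //; exact: hX Xp'.
Qed.

Section TameOrder.
Variable m : nat.
Implicit Types X Y Z : tame_set m.

Let le X Y : bool := `[< val X `<=` val Y >].
Let lt X Y : bool := (Y != X) && le X Y.
Let meet X Y := Tame (tameI (tame_val X) (tame_val Y)).
Let join X Y := Tame (tameU (tame_val X) (tame_val Y)).
Let diff X Y := Tame (tameD (tame_val X) (tame_val Y)).

Let le_def X Y : le X Y = (meet X Y == X).
Proof.
by apply/asboolP/eqP => [/setIidPl E|/(congr1 val)/setIidPl //]; exact: val_inj.
Qed.

Let lt_def X Y : lt X Y = (Y != X) && le X Y.
Proof. by []. Qed.

Let meetC : commutative meet.
Proof. by move=> X Y; apply: val_inj; exact: setIC. Qed.

Let joinC : commutative join.
Proof. by move=> X Y; apply: val_inj; exact: setUC. Qed.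

Let meetA : associative meet.
Proof. by move=> X Y Z; apply: val_inj; exact: setIA. Qed.

Let joinA : associative join.
Proof. by move=> X Y Z; apply: val_inj; exact: setUA. Qed.

Let joinKI Y X : meet X (join X Y) = X.
Proof. by apply: val_inj; rewrite /= setUC setKU. Qed.

Let meetKU Y X : join X (meet X Y) = X.
Proof. by apply: val_inj; rewrite /= setIC setKI. Qed.

Let meetUl : left_distributive meet join.
Proof. by move=> X Y Z; apply: val_inj; exact: setIUl. Qed.

Let meetxx : idempotent_op meet.
Proof. by move=> X; apply: val_inj; exact: setIid. Qed.

HB.instance Definition _ := Order.isMeetJoinDistrLattice.Build set_display
  (tame_set m) le_def lt_def meetC joinC meetA joinA joinKI meetKU meetUl meetxx.

Let le0x X : (Tame (@tame0 m) <= X)%O.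
Proof. by apply/asboolP; exact: sub0set. Qed.

Let lex1 X : (X <= Tame (@tameT m))%O.
Proof. exact/asboolP. Qed.

HB.instance Definition _ := Order.hasBottom.Build set_display (tame_set m) le0x.
HB.instance Definition _ := Order.hasTop.Build set_display (tame_set m) lex1.

Let diffKI X Y : (Y `&` diff X Y)%O = \bot%O.
Proof. by apply: val_inj; rewrite /= setDE setICA setICr setI0. Qed.

Let joinIB X Y : ((X `&` Y) `|` diff X Y)%O = X.
Proof. by apply: val_inj; rewrite /= setUC -setDDr setDv setD0. Qed.

HB.instance Definition _ := Order.BDistrLattice_hasSectionalComplement.Build
  set_display (tame_set m) diffKI joinIB.

Let complE X : Tame (tameC (tame_val X)) = ((\top : tame_set m) `\` X)%O.
Proof. by apply: val_inj; rewrite /= setTD. Qed.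

HB.instance Definition _ := Order.CBDistrLattice_hasComplement.Build
  set_display (tame_set m) complE.

Lemma tame_leE X Y : (X <= Y)%O = (val X `<=` val Y) :> Prop.
Proof. exact: asboolE. Qed.

End TameOrder.

Definition tame_algebra (m : nat) : cylBA m.+3 :=
  @CylBA m.+3 _ (tame_set m) (fun i X => Tame (tame_cyl i (tame_val X))).

Lemma RDf_tame m : RDf (tame_algebra m).
Proof.
exists unit, (fun=> tame_algebra m); split.
  move=> _; exists vertex, (fun X : tame_algebra m => val (X : tame_set m)).
  by split; [split | exact: val_inj].
exists (fun=> id); split=> //; last by move=> x y /(_ tt).
by move=> _ y; exists y.
Qed.

(** * Its atoms: the types of standard points *)

Definition type_class (m : nat) (p : point m) : set (point m) :=
  [set q | marking q = marking p /\ labelling q = labelling p].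

Lemma tame_type_class m (p : point m) : std p -> tame (type_class p).
Proof.
move=> sp; have [N hN] := std_sim_eq sp.
exists N => q r qr [mq lq]; apply: hN.
by case: qr => mqr lqr; split=> [|d]; rewrite -?mq // -lq lqr.
Qed.

Lemma type_class_sub m (p : point m) (X : tame_set m) : val X p ->
  type_class p `<=` val X.
Proof.
move=> Xp q [mq lq]; have [N hN] := tame_val X.
by apply: hN Xp; split=> [|d]; rewrite ?mq ?lq.
Qed.

Lemma type_class_atom m (p : point m) (sp : std p) :
  @is_atom _ (tame_algebra m) (Tame (tame_type_class sp)).
Proof.
split=> [/(congr1 val)/= E|X]; first by have : type_class p p by []; rewrite E.
rewrite tame_leE /= => Xp.
case: (pselect (exists q, val (X : tame_set m) q)) => [[q Xq]|no]; last first.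
  by left; apply: val_inj; apply/seteqP; split=> q // Xq; case: no; exists q.
right; apply: val_inj; apply/seteqP; split=> // r [mr lr].
by apply: (type_class_sub Xq); have [mq lq] := Xp q Xq; split; rewrite ?mr ?lr.
Qed.

Lemma tame_std_mem m (X : tame_set m) : X != \bot%O -> exists2 p, std p & val X p.
Proof.
move=> X0; have [p Xp] : val X !=set0.
  apply/set0P; apply: contraNneq X0 => E; apply/eqP; exact: val_inj.
have [N hN] := tame_val X; have [q sq pq] := std_sim N p.
by exists q => //; exact: hN Xp.
Qed.

Lemma atomic_tame m : atomic (tame_algebra m).
Proof.
move=> X /eqP/tame_std_mem[p sp Xp]; exists (Tame (tame_type_class sp)).
  exact: type_class_atom.
by rewrite tame_leE; exact: type_class_sub.
Qed.

Lemma atomP m (a : tame_algebra m) : is_atom a ->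
  exists2 p, std p & val (a : tame_set m) = type_class p.
Proof.
move=> [/eqP/tame_std_mem[p sp ap] amin]; exists p => //.
have [] := amin (Tame (tame_type_class sp)); first by rewrite tame_leE; exact: type_class_sub.
  by move=> /(congr1 val)/= E; have : type_class p p by []; rewrite E.
by move=> <-.
Qed.

Lemma atom_leE m (a : At (tame_algebra m)) (X : tame_algebra m) p :
  val (sval a : tame_set m) p -> (sval a <= X)%O = val (X : tame_set m) p :> Prop.
Proof.
case: a => a aa /= ap; rewrite tame_leE; apply/propext; split=> [aX|Xp]; first exact: aX.
have [q _ /= aq] := atomP aa; move: ap; rewrite aq => -[mp lp] r [mr lr].
by apply: (type_class_sub Xp); split; rewrite ?mr ?lr.
Qed.

Lemma atom_std m (a : At (tame_algebra m)) :
  exists2 p, std p & val (sval a : tame_set m) p.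
Proof. by case: a => a aa; have [p sp E] := atomP aa; exists p => //; rewrite E. Qed.

Lemma atom_eq m (a b : At (tame_algebra m)) p :
  val (sval a : tame_set m) p -> val (sval b : tame_set m) p -> a = b.
Proof.
move=> ap bp; have ab : sval a = sval b.
  by apply/Order.POrderTheory.le_anti/andP; rewrite (atom_leE _ ap) (atom_leE _ bp).
case: a b ab {ap bp} => a aa [b bb] /= ab; subst b.
by congr exist; exact: Prop_irrelevance.
Qed.

Definition atom_of m (p : point m) (sp : std p) : At (tame_algebra m) :=
  exist _ _ (type_class_atom sp).

Lemma le_cyl_atom_of m (a : At (tame_algebra m)) i p q (sq : std q) :
  val (sval a : tame_set m) p -> agree_off i q p ->
  atom_rel i a (atom_of sq).
Proof.
by move=> ap qp; rewrite /= (atom_leE _ ap); exists q.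
Qed.

(** * The complex algebra as Dedekind-MacNeille completion *)

Definition below m (X : tame_algebra m) : Cm (At (tame_algebra m)) :=
  [set a | (sval a <= X)%O].

Lemma belowE m (X : tame_algebra m) (a : At (tame_algebra m)) p :
  val (sval a : tame_set m) p -> below X a = val (X : tame_set m) p.
Proof. exact: atom_leE. Qed.

(** Membership of an atom is tested at a standard point in it. For cylindrifications, [std_back]
    turns an arbitrary witness into a standard one that the tame set cannot distinguish from it. *)
Lemma below_hom m : is_hom (@below m).
Proof.
have ext (P Q : set (At (tame_algebra m))) :
    (forall a p, std p -> val (sval a : tame_set m) p -> P a <-> Q a) -> P = Q.
  move=> PQ; apply/seteqP; split=> a; have [p sp ap] := atom_std a;
    by have [] := PQ a p sp ap.
split; first split.
- by apply: ext => a p _ ap; rewrite (belowE _ ap).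
- by apply: ext => a p _ ap; rewrite (belowE _ ap).
- move=> X Y; apply: ext => a p _ ap.
  by rewrite -[Q in _ <-> Q]/(below X a /\ below Y a) !(belowE _ ap).
- move=> X Y; apply: ext => a p _ ap.
  by rewrite -[Q in _ <-> Q]/(below X a \/ below Y a) !(belowE _ ap).
- by move=> X; apply: ext => a p _ ap; rewrite -[Q in _ <-> Q]/(~ below X a) !(belowE _ ap).
move=> i X; apply: ext => a p sp ap; rewrite /below /= (atom_leE _ ap) /=.
have [N hN] := tame_val X; split=> [[p' Xp' p'p]|[b bX]].
  have [q [qp sq p'q]] := std_back N sp p'p.
  exists (atom_of sq); last exact: le_cyl_atom_of ap qp.
  by rewrite /= tame_leE; exact/type_class_sub/(hN p').
rewrite (atom_leE _ ap) => -[p' bp' p'p]; exists p' => //.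
by move: bX; rewrite (atom_leE _ bp').
Qed.

(** Standard points are dense: at the larger of the two levels, every point is approximated by a
    standard one. *)
Lemma below_inj m : injective (@below m).
Proof.
have sub X Y : below X = below Y -> val (X : tame_set m) `<=` val (Y : tame_set m).
  move=> XY p Xp; have [N hN] := tame_val X; have [M hM] := tame_val Y.
  have [q sq pq] := std_sim (maxn N M) p.
  have Xq : val (X : tame_set m) q.
    by apply: hN Xp; apply: sim_leq pq; rewrite leq_maxl.
  apply: (hM q); first by apply/sim_sym/(sim_leq _ pq); rewrite leq_maxr.
  have : below Y (atom_of sq) by rewrite -XY /below /= tame_leE; exact: type_class_sub.
  by rewrite /below /= tame_leE; apply.
by move=> X Y XY; apply: val_inj; apply/seteqP; split; exact: sub.
Qed.

Lemma Cm_complete n (F : atom_structure n) : complete (Cm F).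
Proof.
move=> X; exists (\bigcup_(Y in X) Y); split.
  by move=> Y XY; apply/asboolP; exact: bigcup_sup.
by move=> Z ubZ; apply/asboolP; apply: bigcup_sub => Y /ubZ/asboolP.
Qed.

(** Density holds because atoms go to singletons. Cylindrifications of [Cm] are completely additive,
    so the atoms in [b] already attain the supremum. *)
Lemma DM_completion_Cm m : DM_completion (tame_algebra m) (Cm (At (tame_algebra m))).
Proof.
split; first exact: Cm_complete.
exists (@below m); split; [exact: below_hom | exact: below_inj | |].
  move=> b b0; have [a ba] : b !=set0.
    by apply: contrapT => H; apply: b0; apply/seteqP; split=> // a ba; case: H; exists a.
  have [p sp ap] := atom_std a; exists (Tame (tame_type_class sp)).
    by case: (type_class_atom sp).
  apply/asboolP => c; rewrite /below /= => cp; suff -> : c = a by [].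
  have [q sq cq] := atom_std c; have [mq lq] : type_class p q.
    by move: cp; rewrite tame_leE; apply.
  apply: (atom_eq cq); have [N hN] := tame_val (sval a : tame_set m).
  by apply: hN ap; split=> [|d]; rewrite ?mq ?lq.
move=> i b; split.
  move=> _ [X Xb <-]; rewrite (below_hom m).2; apply/asboolP => a [c cX ac].
  by exists c => //; exact: (asboolW Xb).
move=> Z ubZ; apply/asboolP => a [c bc ac].
have /asboolP : (below (cyl i (sval c)) <= Z)%O.
  apply: ubZ; exists (sval c) => //; apply/asboolP => x /=.
  rewrite /below /=; have [p sp xp] := atom_std x.
  by rewrite (atom_leE _ xp) => cp; rewrite (atom_eq xp cp).
by apply.
Qed.

(** * Non-representability of the complex algebra *)

Local Open Scope order_scope.

(** Some subdirect factor separates top from bottom, and a set algebra that does so has a nonempty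
    unit. Injectivity may be lost, but the contradiction needs only a homomorphism. *)
Lemma RDf_hom n (A : cylBA n) : RDf A -> (\top : A) <> \bot ->
  exists (U : Type) (h : A -> full_set_algebra n U),
    is_hom h /\ exists s : 'I_n -> U, True.
Proof.
move=> [J [B [setB [f [fh _ f_inj]]]]] top_bot.
have [j fj] : exists j, f j \top <> f j \bot.
  by apply: contrapT => /forallNP H; apply/top_bot/f_inj => j; exact: contrapT.
have [U [g [[gh gc] g_inj]]] := setB j; have [fjh fjc] := fh j.
exists U, (g \o f j); case: fjh gh => f0 f1 fI fU fC [g0 g1 gI gU gC].
split; first split; first split; rewrite /= ?f0 ?f1 //.
- by move=> x y /=; rewrite fI gI.
- by move=> x y /=; rewrite fU gU.
- by move=> x /=; rewrite fC gC.
- by move=> i x /=; rewrite fjc gc.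
apply: contrapT => H; apply: fj; apply: g_inj; rewrite f0 f1 g0 g1.
by apply/seteqP; split=> // s; case: H; exists s.
Qed.

Definition atoms_in m (X : set (point m)) : Cm (At (tame_algebra m)) :=
  [set a | val (sval a : tame_set m) `<=` X].

Definition marked m (d : three) (a : mark) : set (point m) :=
  [set p | marking p d = a].

(** Not tame, since [trunc N] merges both bits once [s] reaches [N]; but each atom lies inside or
    outside it, so the complex algebra does see colours. *)
Definition coloured m (d : three) (c : colour) : set (point m) :=
  [set p | exists s, labelling p d = (c.1, Some (s, c.2))].

Definition cylindric m (i : 'I_m.+3) (X : set (point m)) : Prop :=
  forall p q, agree_off i p q -> X p -> X q.

Lemma cylindric_marked m d d' a : d' <> d -> cylindric (coord m d') (marked d a).
Proof.
move=> ne p q pq; rewrite /marked /= (marking_off pq) //; exact/coord_neq/nesym.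
Qed.

Lemma cylindric_coloured m d c : cylindric (coord m d) (coloured d c).
Proof. by move=> p q pq [s E]; exists s; rewrite -(labelling_off pq). Qed.

Lemma cyl_atoms_in m i (X : set (point m)) : cylindric i X ->
  cyl i (atoms_in X) = atoms_in X.
Proof.
move=> cX; apply/seteqP; split=> [a [b bX] | a aX].
  rewrite /= tame_leE /= => ab p ap; have [q bq qp] := ab p ap.
  exact: cX qp (bX q bq).
by exists a => //; rewrite /= tame_leE /= => p ap; exists p.
Qed.

Lemma cyl_marked m d a : cyl (coord m d) (atoms_in (marked d a)) = \top.
Proof.
apply/seteqP; split=> // b _; have [p sp bp] := atom_std b.
have [q [qp sq mq]] := mark_free d a sp.
exists (atom_of sq); last exact: le_cyl_atom_of bp qp.
by move=> r [mr _]; rewrite /marked /= mr.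
Qed.

Definition colours : seq colour :=
  [:: (S0, false); (S0, true); (S1, false); (S1, true); (S2, false); (S2, true)].

(** Atoms consist of standard points, whose edges all have a colour. The join is finite, hence
    preserved by every homomorphism. *)
Lemma coloured_cover m d :
  foldr (fun c x => atoms_in (coloured d c) `|` x) \bot colours =
    \top :> Cm (At (tame_algebra m)).
Proof.
apply/seteqP; split=> // a _; have [p sp ap] := atom_std a.
have aE c : coloured d c p -> atoms_in (coloured d c) a.
  move=> [s E] q aq; exists s; case: a ap aq => a aa ap aq.
  have [r _ aE] := atomP aa; move: ap aq; rewrite aE => -[_ lp] [_ lq].
  by rewrite lq -lp.
case E : (labelling p d) (sp d) => [i [[s k]|]] // _.
have : atoms_in (coloured d (i, k)) a by apply: aE; exists s.
by case: i k {E} => -[] H; [right; left | left | right; right; right; left |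
  right; right; left | right; right; right; right; right; left |
  right; right; right; right; left].
Qed.

Lemma hom_cover n (A : cylBA n) (U : Type) (h : A -> full_set_algebra n U)
    (C : Type) (F : C -> A) (cs : seq C) : is_hom h ->
  foldr (fun c x => F c `|` x) \bot cs = \top ->
  forall s, exists c, h (F c) s.
Proof.
move=> [[h0 h1 _ hU _] _] cov s.
have : h \top s by rewrite h1.
rewrite -cov; elim: cs {cov} => [|c cs IH] /=; first by rewrite h0.
by rewrite hU => -[hc|/IH //]; exists c.
Qed.

Lemma not_RDf_Cm m : ~ RDf (Cm (At (tame_algebra m))).
Proof.
move=> /RDf_hom[|U [h [hh [s0 _]]]].
  have [p sp _] := std_sim 0 (fun=> Root S0 mark0 : vertex) : exists2 p : point m, _ & _.
  move=> E; have : (\top : Cm (At (tame_algebra m))) (atom_of sp) by [].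
  by rewrite E.
case: (hh) => -[h0 h1 hI hU hC] hcyl.
have move1 i X s t : cylindric i X -> h (atoms_in X) s ->
    (forall j, j != i -> s j = t j) -> h (atoms_in X) t.
  by move=> cX hs st; rewrite -(cyl_atoms_in cX) hcyl; exists s.
have meet X Y s : h (atoms_in X) s -> h (atoms_in Y) s ->
    h (atoms_in (X `&` Y)%classic) s.
  move=> hX hY; have -> : atoms_in (X `&` Y)%classic = atoms_in X `&` atoms_in Y.
    by apply/seteqP; split=> a; [move=> H; split=> p /H[] | move=> [aX aY] p ap; split;
      [exact: aX | exact: aY]].
  by rewrite hI.
have wit X s : h (atoms_in X) s -> exists p, X p.
  move=> hX; apply: contrapT => noX; suff E : atoms_in X = \bot.
    by move: hX; rewrite E h0.
  by apply/seteqP; split=> // a aX; have [p _ /aX Xp] := atom_std a; case: noX; exists p.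
have [pick pickP] : {pick : three * mark -> U & forall da s,
    (forall j, (forall d, j != coord m d) -> s j = s0 j) ->
    s (coord m da.1) = pick da -> h (atoms_in (marked da.1 da.2)) s}.
  apply: (choice (P := fun da x => forall s,
    (forall j, (forall d, j != coord m d) -> s j = s0 j) ->
    s (coord m da.1) = x -> h (atoms_in (marked da.1 da.2)) s)) => -[d a] /=.
  have : h (cyl (coord m d) (atoms_in (marked d a))) s0 by rewrite cyl_marked h1.
  rewrite hcyl => -[t ht ts].
  exists (t (coord m d)) => s ss sd.
  (* From [t] one reaches [s] by changing coordinate [nxt (nxt d)] and then [nxt d]; the marked set
     is cylindric in both. *)
  pose r j := if j == coord m (nxt d) then t j else s j.
  apply: (move1 (coord m (nxt d)) _ r); last first.
  - by move=> j /negbTE ne; rewrite /r ne.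
  - apply: (move1 (coord m (nxt (nxt d))) _ t) ht _.
      by apply: cylindric_marked; case: (d).
    move=> j ne2; rewrite /r; case: eqP => // /eqP ne1.
    have [->//|ne0] := eqVneq j (coord m d).
    rewrite ts // ss // => d'; case: (d) (d') ne0 ne1 ne2 => -[] //.
  - by apply: cylindric_marked; case: (d).
pose mk (a : three -> mark) : 'I_m.+3 -> U := fun j =>
  if j == coord m S0 then pick (S0, a S0)
  else if j == coord m S1 then pick (S1, a S1)
  else if j == coord m S2 then pick (S2, a S2) else s0 j.
have mkE a d : mk a (coord m d) = pick (d, a d) by case: d.
have mk_marked a d : h (atoms_in (marked d (a d))) (mk a).
  apply: (pickP (d, a d)) => //= j nj.
  by rewrite /mk !(negbTE (nj _)).
have mk_off d a b : (forall d', d' <> d -> a d' = b d') ->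
    forall j, j != coord m d -> mk a j = mk b j.
  move=> ab j jd; rewrite /mk.
  by case: eqP => [E|_]; [|case: eqP => [E|_]; [|case: eqP => [E|_]]] => //;
    rewrite ab // => E'; move: jd; rewrite E E' eqxx.
have [col colP] : {col : three * (three -> mark) -> colour & forall da,
    h (atoms_in (coloured da.1 (col da))) (mk da.2)}.
  apply: (choice (P := fun da c => h (atoms_in (coloured da.1 c)) (mk da.2))).
  by move=> -[d a]; exact: hom_cover hh (coloured_cover m d) _.
(* Colours of the edge opposite to [d] are insensitive to coordinate [d], so a colour found with the
   filler [mark0] there stays correct for the mark chosen later. *)
have colE d a b : (forall d', d' <> d -> a d' = b d') ->
    h (atoms_in (coloured d (col (d, b)))) (mk a).
  move=> ab; apply: move1 (cylindric_coloured (c := _)) (colP (d, b)) _ => /= j jd.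
  by apply: (mk_off d) => // d' ne; rewrite ab.
(* The third mark guesses the colours of the (S0, S1)-edges, the second one then
   guesses those of the (S0, S2)-edges, and the first one that of the last edge. *)
pose a0 (i : colour) : mark := (i, id, fun _ _ => (S0, false)).
pose a1 (g : colour -> colour) : mark := ((S0, false), g, fun _ _ => (S0, false)).
pose a2 (r : colour -> (colour -> colour) -> colour) : mark := ((S0, false), id, r).
pose tri x y z (d : three) : mark := match d with S0 => x | S1 => y | S2 => z end.
pose r i g := col (S2, tri (a0 i) (a1 g) mark0).
pose g i := col (S1, tri (a0 i) mark0 (a2 r)).
pose i := col (S0, tri mark0 (a1 g) (a2 r)).
pose a := tri (a0 i) (a1 g) (a2 r).
have hm d := mk_marked a d.
have h2 : h (atoms_in (coloured S2 (r i g))) (mk a) by apply: colE; case.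
have h1' : h (atoms_in (coloured S1 (g i))) (mk a) by apply: colE; case.
have h0' : h (atoms_in (coloured S0 i)) (mk a) by apply: colE; case.
(* All marks and guessed colours hold at [mk a], so their meet is nonzero and some genuine point has
   them, against the consistency of its triangle. *)
have [p [[[m0 m1] m2] [[c0 c1] c2]]] := wit _ _ (meet _ _ _
  (meet _ _ _ (meet _ _ _ (hm S0) (hm S1)) (hm S2))
  (meet _ _ _ (meet _ _ _ h0' h1') h2)).
apply: (@inconsistent_target (marking p) (labelling p)); last first.
  exact: labelling_consistent.
by case=> /=; rewrite ?m0 ?m1 ?m2.
Qed.

Theorem theorem4p4 (n : nat) (hn : (2 < n)%N) :
  [/\ ~ atom_canonical (@RDf n),
      exists A : cylBA n, [/\ atomic A, RDf A & ~ RDf (Cm (At A))]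
    & ~ closed_under_DM_completions (@RDf n)].
Proof.
case: n hn => [|[|[|m]]] // _.
split=> [ac||dm].
- exact/(@not_RDf_Cm m)/ac/atomic_tame/RDf_tame.
- exists (tame_algebra m); split; [exact: atomic_tame | exact: RDf_tame |].
  exact: not_RDf_Cm.
- exact/(@not_RDf_Cm m)/(dm _ _ (RDf_tame m))/DM_completion_Cm.
Qed.
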